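(* For a poset $P$, we have $\operatorname{iir}(P) = |P|$ if and only if $P$ satisfies the No Block is a Chain Property, the Two Down Property, and the Parallel Pair Property.
   Context: All posets are finite with non-empty ground sets. An inclusion representation of $P$ is a family $\mathcal{S}=\{S_x:x\in P\}$ with $x\le y$ in $P$ iff $S_x\subseteq S_y$. $\mathcal{S}$ is a reduction of $\mathcal{S}'$ if $|\bigcup\mathcal{S}|\le|\bigcup\mathcal{S}'|$ and $|S_x|\le|S'_x|$ for all $x$; a strict reduction if additionally $\mathcal{S}'$ is not a reduction of $\mathcal{S}$; irreducible if it has no strict reduction. $\operatorname{iir}(P)$ is the maximum size of the ground set of an irreducible inclusion representation of $P$. $D_P(x)=\{u:u<x\}$, $D_P[x]=D_P(x)\cup\{x\}$; $x\parallel y$ means $x,y$ distinct and incomparable. No Block is a Chain Property: for every $x\in P$ there is $y\in P$ with $x\parallel y$. Two Down Property: if $y\in P$ covers at least two distinct elements, then there is $z\in P$ with $D_P(y)\subseteq D_P(z)$ and $y\parallel z$. Parallel Pair Property: if $x\parallel y$ in $P$, then (1) there is $y'\in P$ with $D_P(x)\subseteq D_P(y')$, $y\le y'$ and $x\parallel y'$, or (2) there is $x'\in P$ with $D_P(y)\subseteq D_P(x')$, $x\le x'$ and $y\parallel x'$. *)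

(* Defs.v *)
From mathcomp Require Export all_boot all_order.
Set Implicit Arguments.
Unset Strict Implicit.
Unset Printing Implicit Defensive.
Import Order.TTheory.
Local Open Scope order_scope.

Section InclusionRepresentations.
Context {d : Order.disp_t} {P : finPOrderType d}.

(* A family of finite sets is given by subsets of an arbitrary finite type T;
   its ground set is the union of the family, which may be smaller than T. *)
Definition inclusion_rep (T : finType) (S : P -> {set T}) : Prop :=
  forall x y : P, x <= y <-> S x \subset S y.

Definition ground (T : finType) (S : P -> {set T}) : {set T} :=
  \bigcup_(x : P) S x.

(* The two families may live on different types: only cardinalities matter. *)
Definition reduction (T T' : finType)
    (S : P -> {set T}) (S' : P -> {set T'}) : Prop :=
  (#|ground S| <= #|ground S'|)%N /\ forall x : P, (#|S x| <= #|S' x|)%N.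

Definition strict_reduction (T T' : finType)
    (S : P -> {set T}) (S' : P -> {set T'}) : Prop :=
  reduction S S' /\ ~ reduction S' S.

Definition irreducible_rep (T : finType) (S : P -> {set T}) : Prop :=
  inclusion_rep S /\
  ~ exists (T' : finType) (S' : P -> {set T'}),
      inclusion_rep S' /\ strict_reduction S' S.

End InclusionRepresentations.

(* [iir_eq P n] is "iir(P) = n".  The maximum always exists: in an irreducible
   representation two elements of the ground set never belong to the same
   members of the family, so the ground set has at most 2 ^ #|P| elements. *)
Definition iir_eq {d : Order.disp_t} (P : finPOrderType d) (n : nat) : Prop :=
  (exists (T : finType) (S : P -> {set T}),
      irreducible_rep S /\ #|ground S| = n) /\
  (forall (T : finType) (S : P -> {set T}),
      irreducible_rep S -> (#|ground S| <= n)%N).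

Definition down {d : Order.disp_t} {P : finPOrderType d} (x : P) : {set P} :=
  [set u : P | u < x].

Definition covers {d : Order.disp_t} {P : finPOrderType d} (y x : P) : Prop :=
  x < y /\ ~ exists z : P, x < z /\ z < y.

(* [x >< y] is incomparability, which entails [x <> y]. *)

Definition no_block_is_a_chain {d : Order.disp_t} (P : finPOrderType d) : Prop :=
  forall x : P, exists y : P, x >< y.

Definition two_down {d : Order.disp_t} (P : finPOrderType d) : Prop :=
  forall y : P,
    (exists u v : P, [/\ u <> v, covers y u & covers y v]) ->
    exists z : P, down y \subset down z /\ y >< z.

Definition parallel_pair {d : Order.disp_t} (P : finPOrderType d) : Prop :=
  forall x y : P, x >< y ->
    (exists y' : P, [/\ down x \subset down y', y <= y' & x >< y']) \/
    (exists x' : P, [/\ down y \subset down x', x <= x' & y >< x']).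

(* Main.v *)
Require Import Defs.
From mathcomp Require Import all_boot all_order.
From mathcomp Require Import zify.

(** The principal ideals [D[x]] form an inclusion representation with ground
    set [P].  If [S] is irreducible with at least [#|P|] points, then [S]
    satisfies Hall's condition, for otherwise a set of maximal deficiency
    yields a strict reduction; a system of distinct representatives then
    exhibits [D[_]] as a reduction of [S].  Hence iir(P) <= |P|, with equality
    iff [D[_]] is irreducible.  If one of the three properties fails, deleting
    or identifying points reduces [D[_]].  If all three hold, every
    representation [S] with [#|S x| <= #|D[x]|] has the form
    [S x = f @: D[x]] with [f] injective, so it has the same sizes as [D[_]]. *)

Set Implicit Arguments.
Unset Strict Implicit.
Unset Printing Implicit Defensive.
Import Order.TTheory.

(** * Systems of distinct representatives *)

Section Hall.
Variables (I T : finType).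
Implicit Types (F : I -> {set T}) (A : {set I}).

Definition hall F A :=
  forall J : {set I}, J \subset A -> #|J| <= #|\bigcup_(i in J) F i|.

Definition remove_from F i t : I -> {set T} :=
  fun j => if j == i then F j :\ t else F j.

Lemma remove_from_sub F i t j : remove_from F i t j \subset F j.
Proof. by rewrite /remove_from; case: eqP => // _; apply: subD1set. Qed.

Lemma hall_or_deficient F A :
  hall F A \/ exists2 J : {set I}, J \subset A & #|\bigcup_(i in J) F i| < #|J|.
Proof.
have [/forallP h|/forallPn[J]] := boolP [forall J : {set I},
    (J \subset A) ==> (#|J| <= #|\bigcup_(i in J) F i|)].
  by left=> J; apply/implyP.
by rewrite negb_imply -ltnNge => /andP[JA ltJ]; right; exists J.
Qed.

(* Rado's exchange argument: by submodularity of the size of a union, of two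
   points of [F i] at least one can be removed. *)
Lemma hall_remove F A i t1 t2 : hall F A -> i \in A -> t1 != t2 ->
  hall (remove_from F i t1) A \/ hall (remove_from F i t2) A.
Proof.
move=> hF iA t12.
(* If removing [t] from [F i] breaks Hall's condition, every violating set contains [i]; taking [i]
   out of it leaves the [J] of the second alternative. *)
have alt t : hall (remove_from F i t) A \/ exists2 J : {set I},
    (J \subset A) && (i \notin J) &
    #|\bigcup_(j in J) F j :|: (F i :\ t)| <= #|J|.
  have [|[J JA ltJ]] := hall_or_deficient (remove_from F i t) A; first by left.
  have iJ : i \in J.
    apply: contraLR ltJ => niJ; rewrite -leqNgt (leq_trans (hF J JA)) //.
    apply/subset_leq_card/bigcupsP => j jJ.
    apply: subset_trans (bigcup_sup _ jJ); rewrite /remove_from.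
    by case: eqP jJ niJ => // -> ->.
  right; exists (J :\ i).
    by rewrite setD11 andbT (subset_trans (subD1set _ _)).
  rewrite (cardsD1 i J) iJ add1n ltnS in ltJ.
  apply: leq_trans ltJ; apply: subset_leq_card; rewrite subUset.
  apply/andP; split; last first.
    apply: subset_trans (bigcup_sup _ iJ).
    by rewrite /remove_from eqxx.
  apply/bigcupsP => j /setD1P[ji jJ]; apply: subset_trans (bigcup_sup _ jJ).
  by rewrite /remove_from (negPf ji).
have [|[J1 /andP[J1A iJ1] c1]] := alt t1; first by left.
have [|[J2 /andP[J2A iJ2] c2]] := alt t2; first by right.
set X1 := _ :|: _ in c1; set X2 := _ :|: _ in c2.
have iJ : i \notin J1 :|: J2 by rewrite !inE negb_or iJ1.
(* As [t1 != t2], the two truncations of [F i] together cover [F i], so Hall's condition applies to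
   [J1 :|: J2] with [i] added. The extra [i] gives the strict inequality that contradicts [c1] and
   [c2]. *)
have cU : #|J1 :|: J2| < #|X1 :|: X2|.
  have /hF : i |: (J1 :|: J2) \subset A by rewrite !subUset sub1set iA J1A.
  rewrite cardsU1 iJ => /leq_trans; apply; apply: subset_leq_card.
  apply/bigcupsP => j /setU1P[->|/setUP[] jJ].
  - apply/subsetP=> t tF; rewrite !inE tF !andbT.
    by case: (eqVneq t t1) => [->|]; rewrite ?t12 ?orbT.
  - by rewrite -setUA; apply: subset_trans (subsetUl _ _); apply: bigcup_sup.
  - by apply: subset_trans (subsetUr _ _); apply: subset_trans (subsetUl _ _);
      apply: bigcup_sup.
have cI : #|J1 :&: J2| <= #|X1 :&: X2|.
  have /hF : J1 :&: J2 \subset A by rewrite (subset_trans (subsetIl _ _)).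
  move/leq_trans; apply; apply/subset_leq_card/bigcupsP => j /setIP[j1 j2].
  by rewrite subsetI; apply/andP; split;
    apply: subset_trans (subsetUl _ _); apply: bigcup_sup.
have := cardsUI X1 X2; have := cardsUI J1 J2; lia.
Qed.

(** The sets are shrunk by [hall_remove], with induction on their total size, until none has two
    points. Hall's condition on singletons and pairs then makes them distinct singletons. *)
Lemma hall_sdr (t0 : T) F A : hall F A ->
  exists f : I -> T, {in A &, injective f} /\ {in A, forall i, f i \in F i}.
Proof.
have [n] := ubnP (\sum_i #|F i|); elim: n F => // n IHn F ltn hF.
have [/existsP[i /andP[iA gt1]]|] := boolP [exists i in A, 1 < #|F i|].
  have [t1 [t2 [t1F t2F t12]]] := card_gt1P gt1.
  have red t : t \in F i -> hall (remove_from F i t) A ->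
      exists f : I -> T, {in A &, injective f} /\
        {in A, forall i, f i \in F i}.
    move=> tF /IHn[].
      rewrite -ltnS; apply: leq_trans ltn; rewrite ltnS.
      rewrite (bigD1 i) //= [leqRHS](bigD1 i) //=.
      rewrite {1}/remove_from eqxx (cardsD1 t (F i)) tF add1n addSn ltnS.
      rewrite leq_add2l leq_sum // => j ji.
      exact/subset_leq_card/remove_from_sub.
    move=> f [f_inj fF]; exists f; split=> // j /fF.
    exact/subsetP/remove_from_sub.
  by case: (hall_remove hF iA t12) => [/(red _ t1F)|/(red _ t2F)].
rewrite negb_exists => /forallP le1.
have ex1 i : exists t, (i \in A) ==> (F i == [set t]).
  case: (boolP (i \in A)) => iA; last by exists t0.
  suff: #|F i| == 1.
    by case/cards1P=> t ->; exists t; rewrite eqxx implybT.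
  have := hF [set i]; rewrite sub1set iA cards1 big_set1 => /(_ isT).
  by have := le1 i; rewrite iA /=; lia.
have [f fP] := fin_all_exists ex1.
have fE i : i \in A -> F i = [set f i].
  by move=> iA; have := fP i; rewrite iA => /eqP.
exists f; split=> [i j iA jA fij|i iA]; last by rewrite fE ?set11.
apply/eqP; apply: contraTT isT => ij.
have := hF [set i; j]; rewrite subUset !sub1set iA jA cards2 ij.
rewrite bigcup_setU !big_set1 !fE // fij setUid cards1.
by move=> /(_ isT).
Qed.

End Hall.

(** * Principal ideals and the reduction preorder *)

Section Irreducible.
Context {d : Order.disp_t} {P : finPOrderType d}.
Implicit Types (x y z u v : P).

Local Open Scope order_scope.

Definition ideal x : {set P} := [set u | u <= x].

Lemma ideal_rep : inclusion_rep ideal.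
Proof.
move=> x y; split=> [xy|/subsetP/(_ x)]; last by rewrite !inE lexx; apply.
by apply/subsetP=> u; rewrite !inE => /le_trans; apply.
Qed.

Lemma ground_ideal : ground ideal = [set: P].
Proof.
by apply/setP=> x; rewrite inE; apply/bigcupP; exists x; rewrite ?inE.
Qed.

Lemma card_down_lt x y : x < y -> (#|down x| < #|down y|)%N.
Proof.
move=> xy; apply/proper_card/properP; split; last by exists x; rewrite inE ?xy ?ltxx.
by apply/subsetP=> u; rewrite !inE => /lt_trans; apply.
Qed.

Lemma reduction_trans (T1 T2 T3 : finType) (S1 : P -> {set T1})
    (S2 : P -> {set T2}) (S3 : P -> {set T3}) :
  reduction S1 S2 -> reduction S2 S3 -> reduction S1 S3.
Proof.
move=> [g12 h12] [g23 h23]; split=> [|x]; first exact: leq_trans g23.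
exact: leq_trans (h23 x).
Qed.

(** Irreducibility is minimality in a preorder, so whatever lies below a minimal element is
    equivalent to it and again minimal. *)
Lemma irreducible_reduction (T T' : finType) (S : P -> {set T})
    (S' : P -> {set T'}) : irreducible_rep S ->
  inclusion_rep S' -> reduction S' S -> reduction S S' /\ irreducible_rep S'.
Proof.
move=> [repS irr] repS' redS'S.
have redSS' : reduction S S'.
  have [gS|gS] := leqP #|ground S| #|ground S'|; last first.
    case: irr; exists T', S'; split=> //; split=> // -[].
    by rewrite leqNgt gS.
  case: (boolP [forall x, #|S x| <= #|S' x|]%N) => [/forallP //|nle].
  case: irr; exists T', S'; split=> //; split=> // -[_ le].
  by case/negP: nle; apply/forallP.
split=> //; split=> // -[T'' [S'' [repS'' [red nred]]]].
apply: irr; exists T'', S''; split=> //; split.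
  exact: reduction_trans redS'S.
by move=> /(reduction_trans redS'S).
Qed.

(** * Irreducible representations with at least [#|P|] points *)

Lemma irreducible_hall (T : finType) (S : P -> {set T}) (t0 : T) :
  irreducible_rep S -> (#|P| <= #|ground S|)%N -> hall S [set: P].
Proof.
move=> irr leG J0 _; rewrite leqNgt; apply/negP => def0.
pose N (J : {set P}) := \bigcup_(i in J) S i.
(* This is the deficiency of [J] shifted by the constant [#|T|], which avoids truncated
   subtraction. *)
pose w (J : {set P}) := (#|J| + #|~: N J|)%N.
have [A _ maxA] := @arg_maxnP _ J0 xpredT w isT.
have cN J : (#|N J| + #|~: N J| = #|T|)%N by rewrite cardsC.
have defA : (#|N A| < #|A|)%N.
  by have := maxA J0 isT; rewrite /w; have := cN A; have := cN J0;
    rewrite /N in def0 *; lia.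
have hallA : hall (fun x => S x :\: N A) (~: A).
  move=> J /subsetP JA; have := maxA (A :|: J) isT; rewrite /w.
  have -> : #|A :|: J| = (#|A| + #|J|)%N.
    rewrite cardsU; suff -> : A :&: J = set0 by rewrite cards0 subn0.
    apply/setP=> x; rewrite !inE; apply/andP=> -[xA /JA].
    by rewrite inE xA.
  have := cN A; have := cN (A :|: J).
  suff : (#|N (A :|: J)| <= #|N A| + #|\bigcup_(i in J) (S i :\: N A)|)%N by lia.
  apply: leq_trans (leq_card_setU _ _); apply/subset_leq_card/bigcupsP => x.
  case/setUP=> xJ; apply/subsetP=> t tx; apply/setUP.
    by left; apply/bigcupP; exists x.
  case: (boolP (t \in N A)) => tN; [by left | right].
  by apply/bigcupP; exists x; rewrite // inE tN.
have [f [f_inj fS]] := hall_sdr t0 hallA.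
have [repS _] := irr.
(* A set [A] of maximal deficiency keeps its points [N A]; by maximality the
   remaining elements get representatives [f] outside [N A]. *)
pose S' x := S x :&: N A :|: f @: (ideal x :&: ~: A).
have S'S x : S' x \subset S x.
  rewrite subUset subsetIl; apply/subsetP=> _ /imsetP[u /setIP[ux /fS uA] ->].
  case/setDP: uA => uS _; apply: subsetP uS.
  by apply/repS; rewrite inE in ux.
have ltG : (#|ground S'| < #|P|)%N.
  have : ground S' \subset N A :|: f @: (~: A).
    apply/bigcupsP => x _; apply: setUSS; first exact: subsetIr.
    exact/imsetS/subsetIr.
  move/subset_leq_card/leq_ltn_trans; apply.
  apply: leq_ltn_trans (leq_card_setU _ _) _.
  rewrite -(cardsC A); apply: leq_ltn_trans (leq_add (leqnn _) (leq_imset_card _ _)) _.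
  by rewrite ltn_add2r.
have repS' : inclusion_rep S'.
  move=> x y; split=> [xy|sub].
    apply: setUSS; first by apply/setSI/repS.
    by apply/imsetS/setSI/ideal_rep.
  (* For [x] in [A] nothing of [S x] was lost, since [S x] lies in [N A]. Otherwise [f x] lies
     outside [N A], so it is the representative of an element below [y], which is [x] by
     injectivity. *)
  case: (boolP (x \in A)) => xA.
    apply/repS; apply: subset_trans (S'S y); apply: subset_trans sub.
    by apply: subset_trans (subsetUl _ _); rewrite subsetI subxx; apply: bigcup_sup.
  have xA' : x \in ~: A by rewrite inE.
  have /(subsetP sub)/setUP[/setIP[_ fN]|/imsetP[u /setIP[uy uA]]] : f x \in S' x.
  - by apply/setUP; right; apply: imset_f; rewrite inE xA' inE lexx.
  - by have /setDP[_ /negP[]] := fS _ xA'.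
  - by move/(f_inj _ _ xA' uA)=> ->; rewrite inE in uy.
case: irr => _; apply; exists T, S'; split=> //.
have redS' : reduction S' S.
  split=> [|x]; last exact: subset_leq_card.
  exact: ltnW (leq_trans ltG leG).
by split=> // -[]; rewrite leqNgt (leq_trans ltG leG).
Qed.

Lemma irreducible_large (T : finType) (S : P -> {set T}) :
  (0 < #|P|)%N -> irreducible_rep S -> (#|P| <= #|ground S|)%N ->
  (#|ground S| <= #|P|)%N /\ irreducible_rep ideal.
Proof.
move=> P_gt0 irr leG; have [repS _] := irr.
have /card_gt0P[t0 _] : (0 < #|ground S|)%N by apply: leq_trans leG.
have [f [f_inj fS]] := hall_sdr t0 (irreducible_hall t0 irr leG).
have red : reduction ideal S.
  split=> [|x]; first by rewrite ground_ideal cardsT.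
  rewrite -(@card_in_imset _ _ f); last by move=> u v _ _; apply: f_inj; rewrite inE.
  apply/subset_leq_card/subsetP=> _ /imsetP[u ux ->].
  by apply: subsetP (fS u (in_setT u)); apply/repS; rewrite inE in ux.
have [[gS _] irrI] := irreducible_reduction irr ideal_rep red.
by rewrite ground_ideal cardsT in gS.
Qed.

Lemma iir_eq_card : (0 < #|P|)%N -> iir_eq P #|P| <-> irreducible_rep ideal.
Proof.
move=> P_gt0; split=> [[[T [S [irr gS]]] _]|irr].
  by have [] := irreducible_large P_gt0 irr _; rewrite ?gS.
split=> [|T S irrS]; first by exists P, ideal; rewrite ground_ideal cardsT.
rewrite leqNgt; apply/negP=> lt.
by have [] := irreducible_large P_gt0 irrS (ltnW lt); rewrite leqNgt lt.
Qed.

(** * Necessity of the three properties *)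

(* Otherwise deleting the point [y] from all ideals gives a reduction. *)
Lemma irreducible_point y : irreducible_rep ideal ->
  exists z, ~~ (y <= z) && (down y \subset ideal z).
Proof.
move=> [_ irr]; apply/existsP; apply: contraT => /existsPn none.
case: irr; exists P, (fun x => ideal x :\ y); split=> [x z|].
  split=> [xz|/subsetP sub]; first by apply/setSD/ideal_rep.
  case: (eqVneq x y) => [xy|xy]; last first.
    by have := sub x; rewrite !inE xy lexx => /(_ isT).
  subst x; have := none z; case: (boolP (y <= z)) => //= _ /negP[].
  apply/subsetP=> u; rewrite inE => uy; have := sub u.
  by rewrite !inE (lt_eqF uy) (ltW uy) => /(_ isT).
have sub x : ideal x :\ y \subset ideal x by apply: subD1set.
split; first split=> [|x]; try exact: subset_leq_card.
  by rewrite ground_ideal; apply/subset_leq_card/subsetT.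
case=> _ /(_ y); rewrite (cardsD1 y (ideal y)) inE lexx.
by rewrite add1n ltnn.
Qed.

(** Let [z] come from [irreducible_point]. If [z < x], then [z] is the greatest element below [x],
    and anything incomparable to [z], found by induction, is incomparable to [x]. Otherwise [z]
    itself is incomparable to [x]. *)
Lemma irreducible_no_block : irreducible_rep ideal -> no_block_is_a_chain P.
Proof.
move=> irr x; have [n] := ubnP #|down x|; elim: n x => // n IHn x ltn.
have [z /andP[nxz /subsetP xz]] := irreducible_point x irr.
have [zx|nzx] := boolP (z < x); last first.
  exists z; rewrite /Order.comparable negb_or nxz /=.
  by rewrite le_eqVlt negb_or nzx andbT; apply: contraNneq nxz => ->.
have [|y zy] := IHn z; first exact: leq_trans (card_down_lt zx) _.
exists y; apply: contra zy => /orP[xy|].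
  by rewrite /Order.comparable (le_trans (ltW zx) xy).
rewrite le_eqVlt => /predU1P[->|yx]; first by rewrite /Order.comparable (ltW zx).
by have := xz y; rewrite !inE /Order.comparable => /(_ yx) ->; rewrite orbT.
Qed.

(** If the [z] of [irreducible_point] were below [y], it would be the only element covered by
    [y]. *)
Lemma irreducible_two_down : irreducible_rep ideal -> two_down P.
Proof.
move=> irr y [u [v [uv [uy nu] [vy nv]]]].
have [z /andP[nyz /subsetP yz]] := irreducible_point y irr.
have below w : w < y -> w <= z by move=> wy; have := yz w; rewrite !inE; apply.
have [zy|nzy] := boolP (z < y).
  have eqz w : w < y -> ~ (exists t, w < t /\ t < y) -> w = z.
    move=> wy nw; apply/eqP; apply: contraT => wz; case: nw; exists z.
    by rewrite lt_neqAle wz below.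
  by case: uv; rewrite (eqz u) // (eqz v).
exists z; split.
  apply/subsetP=> w; rewrite !inE => wy; rewrite lt_neqAle below // andbT.
  by apply: contraNneq nzy => <-.
rewrite /Order.comparable negb_or nyz /= le_eqVlt negb_or nzy andbT.
by apply: contraNneq nyz => ->.
Qed.

(* Otherwise identifying the points [x] and [y] gives a reduction. *)
Lemma irreducible_parallel_pair : irreducible_rep ideal -> parallel_pair P.
Proof.
move=> [_ irr] x y xy.
case: (boolP [exists y', [&& down x \subset down y', y <= y' & x >< y']]).
  by case/existsP=> y' /and3P[]; left; exists y'.
move/existsPn=> noy.
case: (boolP [exists x', [&& down y \subset down x', x <= x' & y >< x']]).
  by case/existsP=> x' /and3P[]; right; exists x'.
move/existsPn=> nox; case: irr.
pose f u := if u == y then x else u.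
have [nxy nyx] : ~~ (x <= y) /\ ~~ (y <= x) by move: xy; rewrite negb_or => /andP[].
have ney : x != y by apply: contraNneq nxy => ->.
exists P, (fun u => f @: ideal u).
(* This is the failure of one alternative read as an implication. It ensures that the merged point,
   when contributed to [ideal z] by [b] alone, creates no false relation [a <= z]. *)
have key a b z : a >< b ->
    (forall c, ~~ [&& down a \subset down c, b <= c & a >< c]) ->
    b <= z -> (forall u, u < a -> u <= z) -> a <= z.
  move=> ab none bz az; apply: contraT => naz.
  have nza : ~~ (z <= a).
    by apply: contra ab => /(le_trans bz) ba; apply/orP; right.
  case/negP: (none z); apply/and3P; split=> //; last exact/norP.
  apply/subsetP=> u; rewrite !inE => ua; rewrite lt_neqAle az // andbT.
  by apply: contraNneq nza => <-; apply: ltW.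
have fP u z : f u \in f @: ideal z -> u <= z \/
    (u == x) && (y <= z) \/ (u == y) && (x <= z).
  case/imsetP=> v; rewrite inE /f => vz.
  case: (eqVneq u y) => uy; case: (eqVneq v y) => vy; move=> e; subst; auto.
  by right; left; rewrite eqxx.
(* For [a] equal to [x] or [y], no element strictly below [a] is affected by the merging, because
   [x] and [y] are incomparable. *)
have below a z : {subset f @: ideal a <= f @: ideal z} ->
    a >< x \/ a = x -> a >< y \/ a = y -> forall u, u < a -> u <= z.
  move=> sub ax ay u ua.
  have : f u \in f @: ideal z by apply/sub/imset_f; rewrite inE ltW.
  case/fP=> // -[] /andP[/eqP ue _]; subst u.
    case: ax => [/negP[]|ax]; first by apply/orP; right; apply: ltW.
    by rewrite ax ltxx in ua.
  case: ay => [/negP[]|ay]; first by apply/orP; right; apply: ltW.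
  by rewrite ay ltxx in ua.
have yx : y >< x by rewrite /Order.comparable orbC.
split=> [a z|].
  split=> [az|/subsetP sub]; first exact/imsetS/ideal_rep.
  have : f a \in f @: ideal z by apply/sub/imset_f; rewrite inE.
  case/fP=> // -[] /andP[/eqP ae le]; subst a.
    by apply: (key _ y) => //; apply: (below x) => //; auto.
  by apply: (key _ x) => //; apply: (below y) => //; auto.
have gsub : ground (fun u => f @: ideal u) \subset [set~ y].
  apply/bigcupsP => a _; apply/subsetP=> _ /imsetP[u _ ->].
  by rewrite !inE /f; case: (eqVneq u y).
have ltG : (#|ground (fun u => f @: ideal u)| < #|ground ideal|)%N.
  rewrite ground_ideal [ltnRHS](cardsD1 y) in_setT add1n ltnS.
  by rewrite -setTD in gsub; apply: subset_leq_card.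
split; last by case; rewrite leqNgt ltG.
by split=> [|u]; [apply: ltnW | apply: leq_imset_card].
Qed.

(** * Sufficiency of the three properties *)

Lemma le_cover u y : u < y -> exists2 v, u <= v & covers y v.
Proof.
move=> uy.
have [|v /andP[uv vy] maxv] := @arg_maxnP _ u
  [pred v | (u <= v) && (v < y)] (fun v => #|down v|).
  by rewrite /= lexx.
exists v => //; split=> // -[z [vz zy]].
have := maxv z; rewrite /= zy (le_trans uv (ltW vz)) => /(_ isT).
by rewrite /= leqNgt card_down_lt.
Qed.

Lemma down_max_or_two_covers y :
  [\/ down y = set0, exists2 u, u < y & forall v, v < y -> v <= u |
      exists u v, [/\ u <> v, covers y u & covers y v]].
Proof.
have [->|/set0Pn[w]] := eqVneq (down y) set0; first by constructor 1.
rewrite inE => /le_cover[u _ cu].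
case: (boolP [forall v, (v < y) ==> (v <= u)]) => [/forallP max|].
  by constructor 2; exists u; [case: cu | move=> v; apply/implyP].
case/forallPn=> v; rewrite negb_imply => /andP[/le_cover[v' vv' cv'] nvu].
by constructor 3; exists u, v'; split=> // uv; rewrite uv vv' in nvu.
Qed.

(** Without a new point, [S x] is covered by the [S u] with [u < x], so every upper bound of
    [down x] is above [x]. Such a bound not above [x] exists by No Block if [x] is minimal, by Two
    Down if [x] covers two elements, and is the greatest element of [down x] otherwise. *)
Lemma rep_new_point (T : finType) (S : P -> {set T}) x :
  no_block_is_a_chain P -> two_down P -> inclusion_rep S ->
  exists t, (t \in S x) && [forall u, (u < x) ==> (t \notin S u)].
Proof.
move=> nb td repS; apply/existsP; apply: contraT => /existsPn none.
have old t : t \in S x -> exists2 u, u < x & t \in S u.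
  move=> tx; have := none t; rewrite tx => /forallPn[u].
  by rewrite negb_imply negbK => /andP[]; exists u.
have down_le z : (forall u, u < x -> u <= z) -> x <= z.
  move=> xz; apply/repS/subsetP=> t /old[u /xz/repS/subsetP]; apply.
have [x0|[u ux max]|/td[z [/subsetP sub /negP[]]]] := down_max_or_two_covers x.
- have [y /negP[]] := nb x; apply/orP; left; apply: down_le => u ux.
  by move/setP/(_ u): x0; rewrite !inE ux.
- by have := lt_le_trans ux (down_le u max); rewrite ltxx.
- apply/orP; left; apply: down_le => u ux.
  by have := sub u; rewrite !inE => /(_ ux)/ltW.
Qed.

(** The new points [f u] with [u <= x] all lie in [S x]. Once they are known to be distinct, the
    size bound leaves no room for others. *)
Lemma properties_rep_ideal (T : finType) (S : P -> {set T}) :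
  no_block_is_a_chain P -> two_down P -> parallel_pair P ->
  inclusion_rep S -> (forall x, #|S x| <= #|ideal x|)%N ->
  exists2 f : P -> T, injective f & forall x, S x = f @: ideal x.
Proof.
move=> nb td pp repS leS.
have [f fP] := fin_all_exists (fun x => rep_new_point x nb td repS).
have fS x : f x \in S x by have /andP[] := fP x.
have fN u x : u < x -> f x \notin S u.
  by have /andP[_ /forallP/(_ u)/implyP] := fP x.
have fle u x : u <= x -> f u \in S x by move=> /repS/subsetP; apply.
have below x y : S x = f @: ideal x -> down x \subset down y ->
    f x \in S y -> x <= y.
  move=> Sx /subsetP sub fx; apply/repS; rewrite Sx.
  apply/subsetP=> _ /imsetP[u + ->].
  rewrite inE le_eqVlt => /predU1P[-> //|ux]; apply/fle/ltW.
  by have := sub u; rewrite !inE; apply.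
(* If [x] and [y] are incomparable, their common new point lies in [S y'] for every [y'] above [y].
   When [y'] also satisfies [down x \subset down y'], this forces [x <= y'], against the Parallel
   Pair Property; the other case is symmetric. *)
have inj x y : S x = f @: ideal x -> S y = f @: ideal y -> f x = f y -> x = y.
  move=> Sx Sy fxy; case: (comparableP x y) => // [xy|yx|xy].
  - by have := fN _ _ xy; rewrite -fxy fS.
  - by have := fN _ _ yx; rewrite fxy fS.
  - case: (pp x y xy) => [[y' [sub yy' /negP[]]]|[x' [sub xx' /negP[]]]];
      apply/orP; left; apply: below => //.
    + by rewrite fxy fle.
    + by rewrite -fxy fle.
have SE x : S x = f @: ideal x.
  have [n] := ubnP #|down x|; elim: n x => // n IHn x ltn.
  have IH u : u < x -> S u = f @: ideal u.
    by move=> ux; apply: IHn; apply: leq_trans (card_down_lt ux) _.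
  apply/esym/eqP; rewrite eqEcard; apply/andP; split.
    by apply/subsetP=> _ /imsetP[u + ->]; rewrite inE => /fle.
  (* The point [f x] is in no [S u] with [u < x], so only pairs strictly below [x] remain, where the
     induction hypothesis makes [inj] available. *)
  rewrite card_in_imset // => u v; rewrite !inE.
  rewrite !le_eqVlt => /predU1P[->|ux] /predU1P[->|vx] // fuv.
  - by have := fN _ _ vx; rewrite fuv fS.
  - by have := fN _ _ ux; rewrite -fuv fS.
  - by apply: inj fuv; apply: IH.
by exists f => // x y; apply: inj.
Qed.

Lemma properties_irreducible : no_block_is_a_chain P -> two_down P ->
  parallel_pair P -> irreducible_rep ideal.
Proof.
move=> nb td pp; split=> [|[T [S [repS [[_ leS] []]]]]]; first exact: ideal_rep.
have [f f_inj SE] := properties_rep_ideal nb td pp repS leS.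
split=> [|x]; last by rewrite SE card_imset.
rewrite ground_ideal cardsT -(card_codom f_inj); apply/subset_leq_card.
apply/subsetP=> _ /codomP[x ->]; apply/bigcupP; exists x => //.
by rewrite SE imset_f // inE.
Qed.

End Irreducible.

Theorem theorem4p1 (d : Order.disp_t) (P : finPOrderType d) (P_neq0 : (0 < #|P|)%N) :
  iir_eq P #|P| <->
  [/\ no_block_is_a_chain P, two_down P & parallel_pair P].
Proof.
rewrite (iir_eq_card P_neq0); split=> [irr|[]]; last exact: properties_irreducible.
split; [exact: irreducible_no_block | exact: irreducible_two_down |].
exact: irreducible_parallel_pair.
Qed.
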